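(* Let $R$ be a ring with proper involution $*$, let $m\ge 1$ be an integer and let $a\in R$. Then $a\in R^{\overline{W}_m}$ if and only if both of the following hold: (1) $a\in R^D$; (2) there exists $x\in R$ such that $$ax^2=x,\quad [(a^m)^*a^{m+1}x]^*=(a^m)^*a^{m+1}x,\quad a^n=axa^n$$ for some $n\in\mathbb{N}$. In this case, $a^{\overline{W}_m}=aa^Dx$.
   Context: Rings are associative with identity and $\mathbb{N}$ is the set of positive integers. An involution $*$ on $R$ satisfies $(x+y)^*=x^*+y^*$, $(xy)^*=y^*x^*$, $(x^* )^*=x$; it is proper if $x^*x=0$ implies $x=0$. An element $a\in R$ has an $m$-weak group inverse if there exist $x\in R$ and $k\in\mathbb{N}$ with $ax^2=x$, $xa^{k+1}=a^k$ and $(a^k)^*a^{m+1}x=(a^k)^*a^m$; such an $x$ is unique if it exists and is denoted $a^{\overline{W}_m}$. $R^{\overline{W}_m}$ is the set of elements of $R$ having an $m$-weak group inverse. $R^{D}$ is the set of Drazin invertible elements: $a\in R^D$ if there are $x\in R$, $k\in\mathbb{N}$ with $ax^2=x$, $ax=xa$, $a^k=xa^{k+1}$; this unique $x$ is denoted $a^D$. *)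

(* Defs.v *)
From mathcomp Require Import all_boot all_order all_algebra.

Set Implicit Arguments.
Unset Strict Implicit.
Unset Printing Implicit Defensive.

Import GRing.Theory.
Local Open Scope ring_scope.

(* [pzRingType]: associative rings with identity, the zero ring included. *)

Record involution (R : pzRingType) (star : R -> R) : Prop := Involution {
  starD : {morph star : x y / x + y};
  starM : forall x y, star (x * y) = star y * star x;
  starK : involutive star
}.

Definition proper_involution (R : pzRingType) (star : R -> R) : Prop :=
  forall x : R, star x * x = 0 -> x = 0.

(* The exponents k below range over the positive integers. *)

(* [x] is the m-weak group inverse of [a]; for a proper involution
   at most one [x] satisfies this. *)
Definition weak_group_inverse (R : pzRingType) (star : R -> R) (m : nat)
    (a x : R) : Prop :=
  exists k : nat,
    [/\ (0 < k)%N, a * x ^+ 2 = x, x * a ^+ k.+1 = a ^+ k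
      & star (a ^+ k) * a ^+ m.+1 * x = star (a ^+ k) * a ^+ m].

Definition weak_group_invertible (R : pzRingType) (star : R -> R) (m : nat)
    (a : R) : Prop :=
  exists x : R, weak_group_inverse star m a x.

(* [x] is the Drazin inverse of [a]; at most one [x] satisfies this. *)
Definition drazin_inverse (R : pzRingType) (a x : R) : Prop :=
  exists k : nat,
    [/\ (0 < k)%N, a * x ^+ 2 = x, a * x = x * a & a ^+ k = x * a ^+ k.+1].

Definition drazin_invertible (R : pzRingType) (a : R) : Prop :=
  exists x : R, drazin_inverse a x.

(* Main.v *)
Require Import Defs.
From mathcomp Require Import all_boot all_order all_algebra.

Import GRing.Theory.
Local Open Scope ring_scope.

(* If [a x^2 = x] then [x = a^j x^(j+1)] for every [j], so [x] lies in the right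
   ideal of every power of [a].  When [a] has a Drazin inverse [d], this forces
   [d a x = x]: the element [a d x] is just [x].  The theorem therefore says
   that, for Drazin invertible [a], the solutions of (2) are exactly the m-weak
   group inverses of [a].  Properness enters only in uniqueness: two inverses
   [x], [y] give [u = a^(m+1) (x - y)] in [a^k R] with [(a^k)^* u = 0], so
   [u^* u = 0], and [d^(m+1)] cancels [a^(m+1)] on [x] and [y]. *)

Lemma pow_mul_pow_outer_root (R : pzRingType) (a x : R) :
  a * x ^+ 2 = x -> forall j, a ^+ j * x ^+ j.+1 = x.
Proof.
move=> ax2; elim=> [|j IHj]; first by rewrite mul1r expr1.
by rewrite exprSr -(addn2 j) addnC exprD -mulrA (mulrA a) ax2 -exprS.
Qed.

Lemma left_absorb_leq (R : pzRingType) (a x : R) (k l : nat) :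
  x * a ^+ k.+1 = a ^+ k -> (k <= l)%N -> x * a ^+ l.+1 = a ^+ l.
Proof. by move=> xak /subnKC <-; rewrite -addSn !exprD mulrA xak. Qed.

Lemma left_absorb_iter (R : pzRingType) (a x : R) (k j : nat) :
  x * a ^+ k.+1 = a ^+ k -> x ^+ j * a ^+ (k + j) = a ^+ k.
Proof.
move=> xak; elim: j => [|j IHj]; first by rewrite mul1r addn0.
by rewrite exprSr -mulrA addnS (left_absorb_leq _ _ _ _ _ xak) ?leq_addr.
Qed.

(** With [d = x^(k+1) a^k], both [a d] and [d a] collapse to [x^k a^k]: the first because
    [a x^(k+1) = x^k] for positive [k], the second because [x] absorbs one factor of [a^(k+1)]. *)
Lemma outer_root_drazin (R : pzRingType) (a x : R) (k : nat) :
  (0 < k)%N -> a * x ^+ 2 = x -> x * a ^+ k.+1 = a ^+ k ->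
  drazin_inverse a (x ^+ k.+1 * a ^+ k).
Proof.
move=> k_gt0 ax2 xak.
have ad : a * (x ^+ k.+1 * a ^+ k) = x ^+ k * a ^+ k.
  case: k k_gt0 {xak} => // k _.
  by rewrite mulrA -(add2n k) exprD mulrA ax2 -exprS.
have da : x ^+ k.+1 * a ^+ k * a = x ^+ k * a ^+ k.
  by rewrite -mulrA -exprSr exprSr -mulrA xak.
exists k; split=> //.
- rewrite expr2 mulrA ad -mulrA (mulrA (a ^+ k)) pow_mul_pow_outer_root //.
  by rewrite mulrA -exprSr.
- by rewrite ad da.
- by rewrite -mulrA -exprD left_absorb_iter.
Qed.

Lemma drazin_cancel (R : pzRingType) (a d x : R) :
  drazin_inverse a d -> a * x ^+ 2 = x ->
  forall j, d ^+ j * a ^+ j * x = x.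
Proof.
case=> k [_ _ ad dak] ax2 j.
have dax : d * a * x = x.
  rewrite -{1}(pow_mul_pow_outer_root _ _ _ ax2 k) mulrA -(mulrA d) -exprS.
  by rewrite -dak pow_mul_pow_outer_root.
rewrite -exprMn_comm; last exact: esym ad.
by elim: j => [|j IHj]; rewrite ?mul1r // exprSr -mulrA dax.
Qed.

(** Since [v = a^(m+1) x] lies in [a^k R], the defining equation gives [v^* v = v^* a^m]. The left
    side is self-adjoint, so [(a^m)^* v = v^* v] is too. *)
Lemma weak_group_inverse_hermitian (R : pzRingType) (star : R -> R)
    (hstar : involution star) (m : nat) (a x : R) :
  weak_group_inverse star m a x ->
  star (star (a ^+ m) * a ^+ m.+1 * x) = star (a ^+ m) * a ^+ m.+1 * x.
Proof.
case: hstar => _ sM sK [k [_ ax2 _ sak]].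
set v := a ^+ m.+1 * x; rewrite -mulrA -/v.
have vE : v = a ^+ k * (a ^+ m.+1 * x ^+ k.+1).
  by rewrite mulrA -exprD addnC exprD -mulrA pow_mul_pow_outer_root.
have vv : star v * v = star v * a ^+ m.
  by rewrite {1 3}vE sM -!mulrA (mulrA (star (a ^+ k))) sak.
have := congr1 star vv.
by clearbody v; rewrite !sM !sK => <-.
Qed.

Lemma hermitian_weak_group_inverse (R : pzRingType) (star : R -> R)
    (hstar : involution star) (m : nat) (a d x : R) (n : nat) :
  drazin_inverse a d -> (0 < n)%N -> a * x ^+ 2 = x ->
  star (star (a ^+ m) * a ^+ m.+1 * x) = star (a ^+ m) * a ^+ m.+1 * x ->
  a ^+ n = a * x * a ^+ n ->
  weak_group_inverse star m a x.
Proof.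
case: hstar => _ sM sK ha n_gt0 ax2 herm axan.
have [k [_ _ _ dak]] := ha.
have axa l : (n <= l)%N -> a * x * a ^+ l = a ^+ l.
  by move=> /subnKC <-; rewrite exprD mulrA -axan.
have dax : d * a * x = x by have := drazin_cancel _ _ _ _ ha ax2 1; rewrite !expr1.
(* In this exponent, [m] splits off the factor [(a^m)^*] of the Hermitian condition, [n] lets [a x]
   fix the remaining power, and [k] lets [d] absorb a factor of [a]. *)
exists (m + (n + k))%N; split=> //.
- by rewrite addn_gt0 addn_gt0 n_gt0 orbT.
(* With [l = m + n + k]: [x a^(l+1) = d (a x a^(l+1)) = d a^(l+1) = a^l]. *)
- rewrite -{1}dax -!mulrA (mulrA a) axa; last first.
    by rewrite leqW // addnCA leq_addr.
  by rewrite (left_absorb_leq _ _ _ _ _ (esym dak)) // addnA leq_addl.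
(* Self-adjointness replaces [(a^m)^* a^(m+1) x] by [(a^(m+1) x)^* a^m]; what remains is
   [a^(m+1) x a^(n+k) = a^(m+n+k)] under the star. *)
- rewrite exprD sM -!mulrA (mulrA (star (a ^+ m))) -herm -!mulrA sM sK.
  rewrite !mulrA -!sM; congr (star _ * _).
  by rewrite exprSr -!mulrA (mulrA a) axa ?leq_addr.
Qed.

Lemma weak_group_inverse_unique (R : pzRingType) (star : R -> R)
    (hstar : involution star) (hproper : proper_involution star)
    (m : nat) (a d x y : R) :
  drazin_inverse a d -> weak_group_inverse star m a x ->
  weak_group_inverse star m a y -> x = y.
Proof.
case: hstar => _ sM _ ha [k [_ ax2 _ sx]] [l [_ ay2 _ sy]].
suff u0 : a ^+ m.+1 * x - a ^+ m.+1 * y = 0.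
  rewrite -(drazin_cancel _ _ _ _ ha ax2 m.+1) -mulrA (subr0_eq u0) mulrA.
  exact: drazin_cancel.
apply: hproper; set u := _ - _.
(* The two inverses may come with different exponents [k] and [l]; both equations pass to
   [k + l]. *)
have uE : u = a ^+ (k + l) *
    (a ^+ m.+1 * x ^+ (k + l).+1 - a ^+ m.+1 * y ^+ (k + l).+1).
  rewrite mulrBr !mulrA -exprD addnC exprD -!mulrA.
  by rewrite !pow_mul_pow_outer_root.
have sakl z j1 j2 : star (a ^+ j1) * a ^+ m.+1 * z = star (a ^+ j1) * a ^+ m ->
    star (a ^+ (j1 + j2)) * (a ^+ m.+1 * z) = star (a ^+ (j1 + j2)) * a ^+ m.
  by move=> sz; rewrite exprD sM -!mulrA; congr (_ * _); rewrite mulrA.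
rewrite {1}uE sM -mulrA mulrBr sakl // addnC sakl //.
by rewrite subrr mulr0.
Qed.

Theorem theorem3p1 (R : pzRingType) (star : R -> R)
    (hstar : involution star) (hproper : proper_involution star)
    (m : nat) (hm : (1 <= m)%N) (a : R) :
  let star_condition (x : R) : Prop :=
    [/\ a * x ^+ 2 = x,
        star (star (a ^+ m) * a ^+ m.+1 * x) = star (a ^+ m) * a ^+ m.+1 * x
      & exists n : nat, (0 < n)%N /\ a ^+ n = a * x * a ^+ n] in
  (weak_group_invertible star m a <->
     drazin_invertible a /\ exists x : R, star_condition x)
  /\
  (* the m-weak group inverse of a is a a^D x, with d = a^D, for every x as above *)
  (forall d x : R, drazin_inverse a d -> star_condition x ->
     unique (weak_group_inverse star m a) (a * d * x)).
Proof.
move=> star_condition.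
have solution_inverse d x : drazin_inverse a d -> star_condition x ->
    weak_group_inverse star m a x.
  move=> hd [ax2 herm [n [n_gt0 axan]]].
  exact: (hermitian_weak_group_inverse _ _ hstar _ _ _ _ _ hd n_gt0).
split; first split.
- case=> x hx; have [k [k_gt0 ax2 xak _]] := hx; split.
    by exists (x ^+ k.+1 * a ^+ k); exact: outer_root_drazin.
  exists x; split=> //; first exact: weak_group_inverse_hermitian hx.
  exists k; split=> //.
  (* [a x a^k = a x^2 a^(k+1) = x a^(k+1) = a^k]. *)
  by rewrite -{2}xak exprS !mulrA -(mulrA a) -expr2 ax2 -mulrA -exprS xak.
- by case=> -[d hd] [x hx]; exists x; exact: solution_inverse hd hx.
- move=> d x hd hx; have [ax2 _ _] := hx; have [k [_ _ ad _]] := hd.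
  have -> : a * d * x = x.
    by rewrite ad; have := drazin_cancel _ _ _ _ hd ax2 1; rewrite !expr1.
  split; first exact: solution_inverse hd hx.
  move=> y; apply: (weak_group_inverse_unique _ _ hstar hproper _ _ _ _ _ hd).
  exact: solution_inverse hd hx.
Qed.
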